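(* Let $n\geq 3$ be an integer and let $t$ be a positive integer. The hypercube $Q_{n}$ has an interval total $t$-coloring if and only if $$n+1\leq t\leq \frac{(n+1)(n+2)}{2}.$$
   Context: All graphs are finite, undirected, without loops or multiple edges. The hypercube $Q_n$ has vertex set $\{0,1\}^n$, with two vertices adjacent if and only if they differ in exactly one coordinate. A total coloring of a graph $G$ is a coloring of its vertices and edges such that no two adjacent vertices, no two adjacent edges, and no vertex and edge incident to each other get the same color. For a total coloring $\alpha$ and a vertex $v$, $S[v,\alpha]$ denotes the set consisting of $\alpha(v)$ and the colors of all edges incident to $v$. For a positive integer $t$, an interval total $t$-coloring of $G$ is a total coloring $\alpha$ of $G$ with colors $1,\ldots,t$ such that all $t$ colors are used (each on at least one vertex or edge), and for every vertex $v$ the set $S[v,\alpha]$ is an interval of integers (a set of consecutive integers). *)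

(* Defs.v *)
From mathcomp Require Import all_boot.

Set Implicit Arguments.
Unset Strict Implicit.
Unset Printing Implicit Defensive.

Record sgraph := SGraph {
  vertex :> finType;
  adj : rel vertex;
  adj_sym : symmetric adj;
  adj_irr : irreflexive adj
}.

(* An edge is the two-element set of its ends. *)
Definition edges (G : sgraph) : {set {set G}} :=
  [set e : {set G} | [exists x : G, exists y : G, adj x y && (e == [set x; y])]].

(* [ecol] is only meaningful on [edges G]: every condition below restricts to
   edges, so its values on other sets of vertices are irrelevant. *)
Record coloring (G : sgraph) := Coloring {
  vcol : G -> nat;
  ecol : {set G} -> nat
}.

Definition total_coloring (G : sgraph) (a : coloring G) : Prop :=
  [/\ forall x y : G, adj x y -> vcol a x <> vcol a y,
      forall e f : {set G}, e \in edges G -> f \in edges G ->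
        e != f -> e :&: f != set0 -> ecol a e <> ecol a f
    & forall (x : G) (e : {set G}), e \in edges G -> x \in e ->
        vcol a x <> ecol a e].

(* The set S[v, a], as a list. *)
Definition spectrum (G : sgraph) (a : coloring G) (v : G) : seq nat :=
  vcol a v :: [seq ecol a e | e in [set f in edges G | v \in f]].

Definition is_interval (s : seq nat) : Prop :=
  exists p q : nat, forall c : nat, (c \in s) = (p <= c <= q).

Definition interval_total_coloring (G : sgraph) (t : nat) (a : coloring G) : Prop :=
  [/\ total_coloring a,
      (forall v : G, 1 <= vcol a v <= t) /\
      (forall e : {set G}, e \in edges G -> 1 <= ecol a e <= t),
      forall c : nat, 1 <= c <= t ->
        (exists v : G, vcol a v = c) \/
        (exists2 e : {set G}, e \in edges G & ecol a e = c)
    & forall v : G, is_interval (spectrum a v)].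

Definition cube_adj (n : nat) : rel {ffun 'I_n -> bool} :=
  fun x y => #|[set i : 'I_n | x i != y i]| == 1.

Lemma cube_adj_sym (n : nat) : symmetric (@cube_adj n).
Proof.
move=> x y; rewrite /cube_adj; congr (#|pred_of_set _| == 1).
by apply/setP=> i; rewrite !inE eq_sym.
Qed.

Lemma cube_adj_irr (n : nat) : irreflexive (@cube_adj n).
Proof.
move=> x; rewrite /cube_adj (_ : [set i | _] = set0) ?cards0 //.
by apply/setP=> i; rewrite !inE eqxx.
Qed.

Definition hypercube (n : nat) : sgraph :=
  SGraph (@cube_adj_sym n) (@cube_adj_irr n).

Lemma mem_spectrum (G : sgraph) (a : coloring G) (v : G) (c : nat) :
  reflect (c = vcol a v \/
           exists e : {set G}, [/\ e \in edges G, v \in e & ecol a e = c])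
          (c \in spectrum a v).
Proof.
rewrite inE; apply: (iffP orP) => [[/eqP->|/imageP[e]]|[->|[e [eE ve <-]]]].
- by left.
- by rewrite inE => /andP[eE ve] ->; right; exists e.
- by left.
- by right; apply/imageP; exists e; rewrite // inE eE.
Qed.

(* Main.v *)
(** Upper bound: among the [d] differently coloured edges at [x] that lead closer
    to a vertex [y] at distance [d], the least colour is at most [max - (d - 1)],
    where [max] is the largest colour at [x]; crossing that edge raises the maximum
    by at most [n + 1 - d].  Starting from a vertex with spectrum [1 .. n + 1],
    summing over [d = 1 .. n] bounds every colour by [(n + 1)(n + 2) / 2].

    Existence: two colourings of [Q_n] combine to one of [Q_(n+1)] when every new
    edge gets a colour just above or just below both spectra at its ends and
    corresponding vertices have different colours.  Combining a colouring with its
    translate by [n + 2] adds [n + 2] colours.  For small [t] this is replaced by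
    two colourings with the same spectra but different colours at every vertex
    ("mates"); this adds one or two colours and yields mates again. *)
Require Import Defs.
From mathcomp Require Import all_boot zify.

Set Implicit Arguments.
Unset Strict Implicit.
Unset Printing Implicit Defensive.

(** * Edges and stars of the cube *)

Section Cube.

Variable n : nat.
Implicit Types (x y : hypercube n) (i j : 'I_n) (a : coloring (hypercube n)).

Definition toggle i x : hypercube n := [ffun j => x j (+) (j == i)].

Definition cedge x i : {set hypercube n} := [set x; toggle i x].

Lemma toggleK i : involutive (toggle i).
Proof. by move=> x; apply/ffunP=> j; rewrite !ffunE -addbA addbb addbF. Qed.

Lemma toggle_neq i x : toggle i x != x.
Proof. by apply/eqP=> /ffunP/(_ i); rewrite ffunE eqxx; case: (x i). Qed.

Lemma toggle_inj x : injective (toggle^~ x).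
Proof.
move=> i j /ffunP/(_ i); rewrite !ffunE eqxx.
by case: eqP => // _; case: (x i).
Qed.

Lemma adjP x y : reflect (exists i, y = toggle i x) (adj x y).
Proof.
apply: (iffP cards1P) => [[i eqi]|[i ->]]; exists i.
  apply/ffunP=> j; move/setP/(_ j): eqi; rewrite !inE ffunE => <-.
  by case: (x j); case: (y j).
by apply/setP=> j; rewrite !inE ffunE; case: (x j); case: (j == i).
Qed.

Lemma cedge_toggle x i : cedge (toggle i x) i = cedge x i.
Proof. by rewrite /cedge toggleK setUC. Qed.

Lemma mem_cedges x i : cedge x i \in edges (hypercube n).
Proof.
rewrite inE; apply/existsP; exists x; apply/existsP; exists (toggle i x).
by rewrite eqxx andbT; apply/adjP; exists i.
Qed.

Lemma incidentP x (e : {set hypercube n}) :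
  reflect (exists i, e = cedge x i) ((e \in edges _) && (x \in e)).
Proof.
apply: (iffP andP) => [[]|[i ->]]; last by rewrite mem_cedges !inE eqxx.
rewrite inE => /existsP[y /existsP[z /andP[/adjP[i ->] /eqP->]]].
by rewrite !inE => /orP[]/eqP->; exists i; rewrite // cedge_toggle.
Qed.

Lemma cedge_inj x : injective (cedge x).
Proof.
move=> i j /setP/(_ (toggle i x)); rewrite !inE eqxx orbT (negbTE (toggle_neq _ _)).
by move/esym/eqP/toggle_inj.
Qed.

Lemma cedge_eq x y i j : cedge x i = cedge y j -> i = j /\ (y = x \/ y = toggle i x).
Proof.
move=> eq_e; have: y \in cedge x i by rewrite eq_e !inE eqxx.
rewrite !inE => /orP[]/eqP eq_y; rewrite eq_y in eq_e *.
  by split; [apply: cedge_inj eq_e | left].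
split; last by right.
by apply: (@cedge_inj (toggle i x)); rewrite cedge_toggle.
Qed.

Definition star a x : seq nat :=
  vcol a x :: [seq ecol a (cedge x i) | i <- enum 'I_n].

Lemma size_star a x : size (star a x) = n.+1.
Proof. by rewrite /= size_map size_enum_ord. Qed.

Lemma spectrum_star a x : spectrum a x =i star a x.
Proof.
move=> c; apply/mem_spectrum/idP; rewrite inE.
  case=> [->|[e [eE xe <-]]]; rewrite ?eqxx //; apply/orP; right.
  have /incidentP[i ->]: (e \in edges _) && (x \in e) by rewrite eE.
  by apply: map_f; rewrite mem_enum.
case/orP=> [/eqP->|/mapP[i _ ->]]; first by left.
by right; exists (cedge x i); rewrite mem_cedges !inE eqxx.
Qed.

Lemma mem_spectrum_edge a x i : ecol a (cedge x i) \in spectrum a x.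
Proof.
by apply/mem_spectrum; right; exists (cedge x i); rewrite mem_cedges !inE eqxx.
Qed.

(** Adjacent edges and incident vertex-edge pairs both meet at a vertex, so these two conditions are
    distinctness within each [star]. *)
Lemma total_coloringP a :
  total_coloring a <->
  (forall x i, vcol a x <> vcol a (toggle i x)) /\ (forall x, uniq (star a x)).
Proof.
split=> [[vv ee ve]|[vv uq]].
  split=> [x i|x]; first by apply: vv; apply/adjP; exists i.
  rewrite /= ; apply/andP; split.
    apply/mapP=> -[i _]; apply: ve; first exact: mem_cedges.
    by rewrite !inE eqxx.
  rewrite map_inj_uniq ?enum_uniq // => i j eq_ij; apply: contraPeq eq_ij => neq_ij.
  apply: ee; rewrite ?mem_cedges ?(inj_eq (@cedge_inj x)) //.
  by apply/set0Pn; exists x; rewrite !inE eqxx.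
split=> [x _ /adjP[i ->]|e f eE fE neq_ef /set0Pn[x]|x e eE xe]; first exact: vv.
  rewrite inE => /andP[xe xf].
  have /incidentP[i eq_e]: (e \in edges _) && (x \in e) by rewrite eE.
  have /incidentP[j eq_f]: (f \in edges _) && (x \in f) by rewrite fE.
  subst e f; have /= /andP[_ uqe] := uq x => eq_c.
  suff eq_ij: i = j by rewrite eq_ij eqxx in neq_ef.
  by move/injectiveP: uqe; apply.
have /incidentP[i ->]: (e \in edges _) && (x \in e) by rewrite eE.
have /= /andP[nv _] := uq x => eq_c.
by case/mapP: nv; exists i; rewrite ?mem_enum.
Qed.

(** The [n.+1] colours at [x] are distinct, and counting them fixes the length of the interval. *)
Lemma interval_starP a x : uniq (star a x) -> is_interval (spectrum a x) ->
  exists p, forall c, (c \in spectrum a x) = (p <= c <= p + n).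
Proof.
move=> uqs [p [q pq]]; exists p; suff eq_q: q.+1 - p = n.+1.
  by move=> c; rewrite pq; lia.
rewrite -(size_star a x) -(size_iota p (q.+1 - p)); apply/eqP.
rewrite (perm_size (s2 := star a x)) // uniq_perm ?iota_uniq // => c.
by rewrite -spectrum_star pq mem_iota; lia.
Qed.

(** * Distance and the upper bound on the number of colours *)

Definition dist x y := #|[set i | x i != y i]|.

Lemma dist_toggle x y i : x i != y i -> dist x y = (dist (toggle i x) y).+1.
Proof.
move=> neq_i; rewrite /dist (cardsD1 i) inE neq_i; congr (_.+1).
apply: eq_card => j; rewrite !inE ffunE.
case: eqP => [->|_] /=; last by rewrite addbF.
by move: neq_i; case: (x i); case: (y i).
Qed.

Lemma dist_max x y : dist x y <= n.
Proof. by rewrite -[leqRHS]card_ord max_card. Qed.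

(** Induction on the distance. All spectra have the same length, so least colours rise exactly as
    largest ones do; the summand [n - d] belongs to the step taken at distance [d.+1]. *)
Lemma lo_bound a (lo : hypercube n -> nat) :
    (forall x, uniq (star a x)) ->
    (forall x c, (c \in spectrum a x) = (lo x <= c <= lo x + n)) ->
  forall x y, lo y <= lo x + \sum_(d < dist x y) (n - d).
Proof.
move=> uqs loP x y; move eq_d: (dist x y) => d.
elim: d x eq_d => [|d IHd] x eq_d.
  rewrite big_ord0 addn0; suff -> : x = y by [].
  apply/ffunP=> i; apply/eqP; move/eqP: eq_d; rewrite cards_eq0.
  by move/eqP/setP/(_ i); rewrite !inE => /negbFE.
have lt_dn: d < n by rewrite -eq_d dist_max.
have edgeP i : lo x <= ecol a (cedge x i) <= lo x + n.
  by rewrite -loP mem_spectrum_edge.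
have inj_x : injective (fun i => ecol a (cedge x i)).
  by have /= /andP[_ /injectiveP] := uqs x.
(* Pigeonhole: otherwise [d.+1] distinct colours would lie among the [d] largest colours at [x]. *)
have [i neq_i le_i]: exists2 i, x i != y i & ecol a (cedge x i) <= lo x + (n - d).
  apply/exists_inP; apply: contraLR (leqnn d.+1); rewrite -ltnNge ltnS.
  move/exists_inPn => gt_d; rewrite -[in X in X <= _]eq_d /dist.
  rewrite cardE -(size_map (fun i => ecol a (cedge x i))).
  rewrite -(size_iota (lo x + (n - d)).+1 d); apply: uniq_leq_size.
    by rewrite map_inj_uniq ?enum_uniq.
  move=> _ /mapP[i + ->]; rewrite mem_enum inE mem_iota => /gt_d.
  by have := edgeP i; lia.
have /(IHd _)/leq_trans-> //: dist (toggle i x) y = d.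
  by move: eq_d; rewrite (dist_toggle neq_i) => -[].
rewrite big_ord_recr /= addnA addnAC leq_add2r.
have: ecol a (cedge x i) \in spectrum a (toggle i x).
  by rewrite -cedge_toggle mem_spectrum_edge.
by rewrite loP; lia.
Qed.

(** A difference of two triangular numbers, doubled and rearranged to avoid division and
    subtraction. *)
Lemma sum_sub d : d <= n -> (\sum_(k < d) (n - k)) * 2 + (n - d) * (n - d).+1 = n * n.+1.
Proof.
elim: d => [|d IHd] le_dn; first by rewrite big_ord0 subn0.
rewrite big_ord_recr /= -IHd 1?ltnW // -(subnSK le_dn).
by move: (n - d.+1) (\sum_(_ < _) _) => m S; nia.
Qed.

Lemma cube_spectra_bound t a :
  interval_total_coloring t a -> 0 < t -> n.+1 <= t <= n.+1 * n.+2 %/ 2.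
Proof.
move=> [/total_coloringP[_ uqs] [rv re] used itv] t_gt0.
have [lo loP] : exists lo : hypercube n -> nat,
    forall x c, (c \in spectrum a x) = (lo x <= c <= lo x + n).
  apply: (@fin_all_exists _ _ (fun x p => forall c, _ = (p <= c <= p + n))) => x.
  exact: interval_starP.
have spP x c : c \in spectrum a x -> 0 < c <= t.
  by case/mem_spectrum=> [->|[e [eE _ <-]]]; [apply: rv | apply: re].
have usedP c : 0 < c <= t -> exists x, c \in spectrum a x.
  case/used=> [[x <-]|[e eE <-]]; first by exists x; rewrite inE eqxx.
  move: (eE); rewrite inE => /existsP[x /existsP[y /andP[_ /eqP eq_e]]].
  by exists x; apply/mem_spectrum; right; exists e; rewrite eE eq_e !inE eqxx.
have lo_gt0 x : 0 < lo x by have /spP/andP[]: lo x \in spectrum a x by rewrite loP; lia.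
have hi_le x : lo x + n <= t by have /spP/andP[]: lo x + n \in spectrum a x by rewrite loP; lia.
have [x] : exists x, 1 \in spectrum a x by apply: usedP.
have [y] : exists y, t \in spectrum a y by apply: usedP; lia.
(* Here [lo x = 1], so [t <= lo y + n <= 1 + n + n * n.+1 / 2], which is the claimed bound. *)
rewrite !loP => ty x1.
have := lo_bound uqs loP x y; have := sum_sub (dist_max x y).
have := hi_le x; have := lo_gt0 x; rewrite leq_divRL //.
by move: (\sum_(_ < _) _) => S; nia.
Qed.

End Cube.

(** * Colourings on bit lists and their transfer to the cube *)

Definition flip i (s : seq bool) := set_nth false s i (~~ nth false s i).

(* [be c i s] colours the edge from [s] in direction [i], and [lo c s] is meant to
   be the least colour at [s]; only lists of length [n] matter. *)
Record bitcol := Bitcol {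
  bv : seq bool -> nat;
  be : nat -> seq bool -> nat;
  lo : seq bool -> nat
}.

(** One [perm_eq] encodes both distinctness and the interval condition at [s]. The test is boolean
    so that tables can be checked by computation. *)
Definition vertex_ok n c s :=
  perm_eq (bv c s :: [seq be c i s | i <- iota 0 n]) (iota (lo c s) n.+1) &&
  all (fun i => (be c i (flip i s) == be c i s) && (bv c (flip i s) != bv c s))
    (iota 0 n).

Definition proper n c := forall s, size s = n -> vertex_ok n c s.

(** Since spectra are intervals, use of a colour is expressed through [lo] alone. *)
Definition onto n t c :=
  (forall s, size s = n -> 0 < lo c s /\ lo c s + n <= t) /\
  (forall k, 0 < k <= t -> exists2 s, size s = n & lo c s <= k <= lo c s + n).

Lemma vertex_okP n c s :
  reflect (perm_eq (bv c s :: [seq be c i s | i <- iota 0 n]) (iota (lo c s) n.+1) /\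
           forall i, i < n -> be c i (flip i s) = be c i s /\ bv c (flip i s) <> bv c s)
          (vertex_ok n c s).
Proof.
apply: (iffP andP) => -[pe fl]; split=> //.
  by move=> i lt_in; move/allP/(_ i): fl; rewrite mem_iota => /(_ lt_in)/andP[/eqP-> /eqP].
by apply/allP=> i; rewrite mem_iota => /fl[-> /eqP->]; rewrite eqxx.
Qed.

Definition bits n (x : hypercube n) : seq bool := codom (x : {ffun 'I_n -> bool}).

Lemma nth_bits n (x : hypercube n) (i : 'I_n) : nth false (bits x) i = x i.
Proof. by rewrite (nth_map i) ?size_enum_ord // nth_ord_enum. Qed.

Lemma size_bits n (x : hypercube n) : size (bits x) = n.
Proof. by rewrite size_codom card_ord. Qed.

Lemma bits_toggle n (x : hypercube n) i : bits (toggle i x) = flip i (bits x).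
Proof.
apply: (@eq_from_nth _ false) => [|j].
  by rewrite size_set_nth !size_bits; move: (ltn_ord i); lia.
rewrite size_bits => lt_jn; rewrite -[j]/(val (Ordinal lt_jn)).
move: (Ordinal lt_jn) => {lt_jn}k; rewrite nth_bits nth_set_nth /= ffunE !nth_bits.
by rewrite (inj_eq val_inj); case: eqP => [->|_]; rewrite ?addbT ?addbF.
Qed.

Lemma bits_surj n s : size s = n -> exists x : hypercube n, bits x = s.
Proof.
move=> sz_s; exists [ffun i : 'I_n => nth false s i].
apply: (@eq_from_nth _ false) => [|j]; rewrite size_bits // => lt_jn.
by rewrite -[j]/(val (Ordinal lt_jn)) nth_bits ffunE.
Qed.

Definition cube_coloring n c : coloring (hypercube n) :=
  Coloring (fun x => bv c (bits x))
    (fun e => if [pick p : hypercube n * 'I_n | e == cedge p.1 p.2] is Some p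
              then be c p.2 (bits p.1) else 0).

Lemma cube_coloringP n t c :
  proper n c -> onto n t c -> exists a : coloring (hypercube n), interval_total_coloring t a.
Proof.
move=> pc [rng cov]; exists (cube_coloring n c); set a := cube_coloring n c.
have /= okP (x : hypercube n) := vertex_okP _ _ _ (pc _ (size_bits x)).
have ecolE (x : hypercube n) i : ecol a (cedge x i) = be c i (bits x).
  (* The pick may return either end of the edge; invariance of [be] under [flip] makes the choice
     harmless. *)
  rewrite /=; case: pickP => [[y j] /= /eqP/cedge_eq[<- [->|->]] //|/(_ (x, i))].
    by rewrite bits_toggle; have [_ /(_ i (ltn_ord i))[]] := okP x.
  by rewrite eqxx.
have starE x : perm_eq (star a x) (iota (lo c (bits x)) n.+1).
  have [+ _] := okP x; congr (perm_eq (_ :: _) _).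
  rewrite -val_enum_ord -map_comp; apply: eq_map => i.
  exact: esym (ecolE _ _).
have specE x k : (k \in spectrum a x) = (lo c (bits x) <= k <= lo c (bits x) + n).
  by rewrite spectrum_star (perm_mem (starE x)) mem_iota; lia.
have specP x k : k \in spectrum a x -> 0 < k <= t.
  by rewrite specE; have := rng _ (size_bits x); lia.
split.
- apply/total_coloringP; split=> x; last by rewrite (perm_uniq (starE x)) iota_uniq.
  move=> i /=; rewrite bits_toggle => eq_v.
  by have [_ /(_ i (ltn_ord i))[_ []]] := okP x.
- split=> [x|e eE]; first by apply: (specP x); rewrite inE eqxx.
  move: (eE); rewrite inE => /existsP[x /existsP[y /andP[_ /eqP eq_e]]].
  by apply: (specP x); apply/mem_spectrum; right; exists e; rewrite eE eq_e !inE eqxx.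
- move=> k /cov[s sz_s lo_k]; have [x eq_x] := bits_surj sz_s.
  have: k \in spectrum a x by rewrite specE eq_x.
  by case/mem_spectrum=> [->|[e [eE _ <-]]]; [left; exists x | right; exists e].
- by move=> x; exists (lo c (bits x)), (lo c (bits x) + n) => k; rewrite specE.
Qed.

(** * Shifting, gluing and mates *)

Definition shift k c :=
  Bitcol (fun s => bv c s + k) (fun i s => be c i s + k) (fun s => lo c s + k).

Lemma shift_proper k n c : proper n c -> proper n (shift k c).
Proof.
move=> pc s /pc/vertex_okP[pe fl]; apply/vertex_okP; split=> /= [|i /fl[-> ne]].
  move: (perm_map (addn k) pe) => /=; rewrite -map_comp -iotaDl /= (addnC k) (addnC (lo c s)).
  by congr (perm_eq (_ :: _) _); [apply: eq_map => i /=; rewrite addnC | rewrite addnS].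
by split=> // /addIn.
Qed.

(** The head bit selects the copy, so direction 0 is the matching between the copies and old
    directions move up by one. [minn] gives the least colour whether [w] lies below or above the old
    interval. *)
Definition glue c0 c1 w :=
  Bitcol (fun s => if s is b :: s' then bv (if b then c1 else c0) s' else 0)
    (fun i s => if s is b :: s' then
        if i is i'.+1 then be (if b then c1 else c0) i' s' else w s' else 0)
    (fun s => if s is b :: s' then minn (w s') (lo (if b then c1 else c0) s') else 0).

Definition adjacent n c s w := (w.+1 == lo c s) || (w == lo c s + n.+1).

Lemma glue_proper n c0 c1 w :
    proper n c0 -> proper n c1 ->
    (forall s, size s = n -> bv c0 s <> bv c1 s) ->
    (forall s, size s = n -> adjacent n c0 s (w s)) ->
    (forall s, size s = n -> adjacent n c1 s (w s)) ->
  proper n.+1 (glue c0 c1 w).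
Proof.
move=> p0 p1 ne a0 a1 [//|b s] [sz_s]; apply/vertex_okP.
set cb := if b then c1 else c0.
have ab : adjacent n cb s (w s) by rewrite /cb; case: b {cb}; [apply: a1 | apply: a0].
have /vertex_okP[pe fl]: vertex_ok n cb s by rewrite /cb; case: b {cb ab}; [apply: p1 | apply: p0].
split=> /= [|[_|i lt_in]] /=; last 2 first.
- split=> //; rewrite /cb; have := ne s sz_s.
  by case: b {cb ab pe fl} => //= neq eq_v; apply: neq; rewrite eq_v.
- exact: fl.
rewrite -/cb -[1]/(1 + 0) iotaDl -map_comp.
set L := [seq _ | i <- _]; have {}pe : perm_eq (bv cb s :: L) (iota (lo cb s) n.+1) := pe.
apply: (@perm_trans _ (w s :: bv cb s :: L)).
  by rewrite -[_ :: w s :: L]/([:: bv cb s] ++ [:: w s] ++ L) perm_catCA.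
apply: (@perm_trans _ (w s :: iota (lo cb s) n.+1)); first by rewrite perm_cons.
(* The new colour extends the interval at its bottom or at its top. *)
case/orP: ab => [/eqP <-|/eqP ->].
  by rewrite (minn_idPl (leqnSn _)).
rewrite (minn_idPr (leq_addr _ _)); apply: (@perm_trans _ (iota (lo cb s) (n.+1 + 1))).
  by rewrite iotaD -cat1s perm_catC.
by rewrite addn1.
Qed.

Definition realizable n t := exists2 c, proper n c & onto n t c.

(** [onto] depends only on [lo], on which [c] and [d] agree, so it is recorded once. *)
Definition mated n t := exists c d,
  [/\ proper n c, proper n d, onto n t c,
      forall s, size s = n -> lo c s = lo d s
    & forall s, size s = n -> bv c s <> bv d s].

Lemma mated_realizable n t : mated n t -> realizable n t.
Proof. by move=> [c [d [pc _ oc _ _]]]; exists c. Qed.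

(** Exchanging the two copies yields the mate: spectra stay the same while vertex colours are
    swapped. *)
Lemma mated_glue n t c d w :
    proper n c -> proper n d ->
    (forall s, size s = n -> lo c s = lo d s) ->
    (forall s, size s = n -> bv c s <> bv d s) ->
    (forall s, size s = n -> adjacent n c s (w s)) ->
    onto n.+1 t (glue c d w) ->
  mated n.+1 t.
Proof.
move=> pc pd lo_cd ne ac oc.
have ad s : size s = n -> adjacent n d s (w s).
  by move=> sz_s; rewrite /adjacent -lo_cd //; apply: ac.
have ne' s : size s = n -> bv d s <> bv c s by move=> /ne + /esym.
exists (glue c d w), (glue d c w); split=> //; try exact: glue_proper.
  by move=> [//|[] s] [sz_s] /=; rewrite lo_cd.
by move=> [//|[] s] [sz_s] /=; [apply: ne' | apply: ne].
Qed.

Lemma mated_succ n t : mated n t -> mated n.+1 t.+1.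
Proof.
move=> [c [d [pc pd [rng cov] lo_cd ne]]].
apply: (mated_glue (w := fun s => lo c s + n.+1) pc pd lo_cd ne) => [s _|].
  by rewrite /adjacent eqxx orbT.
split=> [[//|b s] [sz_s]|k k_t] /=.
  have := rng s sz_s; rewrite (_ : lo (if b then d else c) s = lo c s); first lia.
  by case: b; rewrite // lo_cd.
have t_gt0: 0 < t by have := rng _ (size_nseq n false); lia.
(* An interval containing [t] ends there, so its extension contains [t.+1]. *)
have [s sz_s lo_k] := cov (minn k t) ltac:(lia).
by exists (false :: s); rewrite /= ?sz_s //; lia.
Qed.

(* The new edges extend the intervals downwards where these are lowest, and
   upwards elsewhere. *)
Lemma mated_succ2 n t : n.+2 <= t -> mated n t -> mated n.+1 t.+2.
Proof.
move=> lt_nt [c [d [pc pd [rng cov] lo_cd ne]]].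
pose w s := if lo c s == 1 then 1 else lo c s + n.+2.
apply: (@mated_glue _ _ (shift 1 c) (shift 1 d) w); try exact: shift_proper.
- by move=> s /lo_cd /= ->.
- by move=> s /ne /= neq /addIn.
- by move=> s _; rewrite /adjacent /w /=; case: (lo c s =P 1) => [->|_] //; apply/orP; right; lia.
have minE b s : size s = n ->
    lo (glue (shift 1 c) (shift 1 d) w) (b :: s) = if lo c s == 1 then 1 else (lo c s).+1.
  move=> sz_s /=; rewrite (_ : lo _ s = (lo c s).+1); first by rewrite /w; case: eqP; lia.
  by case: b; rewrite /= ?lo_cd // addn1.
split=> [[//|b s] [sz_s]|k k_t].
  by rewrite minE //; have := rng s sz_s; case: eqP; lia.
(* Colour 1 comes from an interval starting at 1. For [k = t.+2], the interval ending at [t] starts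
   above 1 because [n.+2 <= t], so it is extended upwards. *)
have [s sz_s lo_s] := cov (maxn 1 (minn k.-1 t)) ltac:(lia).
have [lo_gt0 _] := rng s sz_s.
exists (false :: s); first by rewrite /= sz_s.
by rewrite minE //; case: eqP; lia.
Qed.

(** Translation by [n.+2] leaves a gap of exactly one colour between the two spectra, and the new
    edge fills it. *)
Lemma realizable_shift n t : n < t -> realizable n t -> realizable n.+1 (t + n.+2).
Proof.
move=> lt_nt [c pc [rng cov]]; pose w s := lo c s + n.+1.
exists (glue c (shift n.+2 c) w).
  apply: glue_proper => //; first exact: shift_proper.
  - by move=> s _ /=; lia.
  - by move=> s _; rewrite /adjacent eqxx orbT.
  - by move=> s _; rewrite /adjacent /w /=; apply/orP; left; lia.
split=> [[//|[] s] [sz_s] /=|k k_t]; try by have := rng s sz_s; rewrite /w; lia.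
(* The unshifted copy covers colours up to [t.+1]; beyond that [k] exceeds [n.+2], as [n < t], and
   the shifted copy covers it. *)
have [k1|k_gt1] := leqP k t.+1.
  have [s sz_s lo_s] := cov (minn k t) ltac:(lia).
  by exists (false :: s); rewrite /= ?sz_s // /w; lia.
have [s sz_s lo_s] := cov (k - n.+2) ltac:(lia).
by exists (true :: s); rewrite /= ?sz_s // /w; lia.
Qed.

(** * Boolean checks and explicit tables in dimensions 2 and 3 *)

Fixpoint bitseqs n : seq (seq bool) :=
  if n is n'.+1 then map (cons false) (bitseqs n') ++ map (cons true) (bitseqs n')
  else [:: [::]].

Lemma mem_bitseqs n s : (s \in bitseqs n) = (size s == n).
Proof.
elim: n s => [|n IHn] [|b s] //=.
  by rewrite mem_cat; apply/norP; split; apply/mapP=> -[].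
have inj (b' : bool) : injective (cons b') by move=> ? ? [].
rewrite eqSS -IHn mem_cat; case: b; rewrite (mem_map (inj _)).
  by apply/orb_idl=> /mapP[].
by apply/orb_idr=> /mapP[].
Qed.

(* Row [idx s] of the table lists the colour of vertex [s] and those of its
   edges in directions 0, 1, ...; the head of [s] is the least significant bit. *)
Definition tabcol (T : seq (seq nat)) : bitcol :=
  let row s := nth [::] T (foldr (fun (b : bool) k => b + k.*2) 0 s) in
  Bitcol (fun s => nth 0 (row s) 0) (fun i s => nth 0 (row s) i.+1)
    (fun s => foldr minn (head 0 (row s)) (row s)).

Definition check_proper n c := all (vertex_ok n c) (bitseqs n).

Definition check_onto n t c :=
  all (fun s => (0 < lo c s) && (lo c s + n <= t)) (bitseqs n) &&
  all (fun k => has (fun s => lo c s <= k <= lo c s + n) (bitseqs n)) (iota 1 t).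

Definition check_mates n c d :=
  all (fun s => (lo c s == lo d s) && (bv c s != bv d s)) (bitseqs n).

Lemma check_properP n c : check_proper n c -> proper n c.
Proof. by move/allP=> ok s /eqP; rewrite -mem_bitseqs; apply: ok. Qed.

Lemma check_ontoP n t c : check_onto n t c -> onto n t c.
Proof.
case/andP=> /allP rng /allP cov; split=> [s /eqP|k k_t].
  by rewrite -mem_bitseqs => /rng/andP[].
have /cov/hasP[s]: k \in iota 1 t by rewrite mem_iota add1n ltnS.
by rewrite mem_bitseqs => /eqP; exists s.
Qed.

Lemma check_realizable n t c : check_proper n c && check_onto n t c -> realizable n t.
Proof. by case/andP=> /check_properP pc /check_ontoP oc; exists c. Qed.

Lemma check_mated n t c d :
  [&& check_proper n c, check_proper n d, check_onto n t c & check_mates n c d] ->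
  mated n t.
Proof.
case/and4P=> /check_properP pc /check_properP pd /check_ontoP oc /allP m.
exists c, d; split=> // s /eqP; rewrite -mem_bitseqs => /m/andP[/eqP ? /eqP ?] //.
Qed.

Lemma mated3_4 : mated 3 4.
Proof.
apply: (@check_mated _ _
  (tabcol [:: [:: 1; 2; 3; 4]; [:: 4; 2; 1; 3]; [:: 2; 4; 3; 1]; [:: 3; 4; 1; 2];
      [:: 3; 1; 2; 4]; [:: 2; 1; 4; 3]; [:: 4; 3; 2; 1]; [:: 1; 3; 4; 2]])
  (tabcol [:: [:: 2; 1; 3; 4]; [:: 3; 1; 4; 2]; [:: 4; 2; 3; 1]; [:: 1; 2; 4; 3];
      [:: 1; 3; 2; 4]; [:: 4; 3; 1; 2]; [:: 3; 4; 2; 1]; [:: 2; 4; 1; 3]])).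
by vm_compute.
Qed.

Lemma mated3_5 : mated 3 5.
Proof.
apply: (@check_mated _ _
  (tabcol [:: [:: 1; 2; 4; 3]; [:: 3; 2; 1; 4]; [:: 2; 3; 4; 5]; [:: 4; 3; 1; 2];
      [:: 4; 5; 2; 3]; [:: 2; 5; 3; 4]; [:: 3; 4; 2; 5]; [:: 1; 4; 3; 2]])
  (tabcol [:: [:: 2; 1; 3; 4]; [:: 4; 1; 2; 3]; [:: 5; 4; 3; 2]; [:: 3; 4; 2; 1];
      [:: 3; 2; 5; 4]; [:: 5; 2; 4; 3]; [:: 4; 3; 5; 2]; [:: 2; 3; 4; 1]])).
by vm_compute.
Qed.

Lemma mated3_6 : mated 3 6.
Proof.
apply: (@check_mated _ _
  (tabcol [:: [:: 1; 2; 3; 4]; [:: 3; 2; 4; 1]; [:: 4; 5; 3; 6]; [:: 2; 5; 4; 3];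
      [:: 2; 3; 5; 4]; [:: 4; 3; 2; 1]; [:: 3; 4; 5; 6]; [:: 5; 4; 2; 3]])
  (tabcol [:: [:: 2; 1; 3; 4]; [:: 4; 1; 2; 3]; [:: 5; 4; 3; 6]; [:: 3; 4; 2; 5];
      [:: 3; 2; 5; 4]; [:: 1; 2; 4; 3]; [:: 4; 3; 5; 6]; [:: 2; 3; 4; 5]])).
by vm_compute.
Qed.

(** The value between the mated range 4 to 6 and the range 8 to 10 obtained by shifting from
    dimension 2. *)
Lemma realizable3_7 : realizable 3 7.
Proof.
apply: (@check_realizable _ _
  (tabcol [:: [:: 1; 2; 3; 4]; [:: 3; 2; 1; 4]; [:: 5; 4; 3; 2]; [:: 2; 4; 1; 3];
      [:: 2; 5; 3; 4]; [:: 7; 5; 6; 4]; [:: 1; 4; 3; 2]; [:: 5; 4; 6; 3]])).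
by vm_compute.
Qed.

Lemma realizable2 t : 4 <= t <= 6 -> realizable 2 t.
Proof.
case/andP=> t4 t6; have : t \in [:: 4; 5; 6] by rewrite !inE; lia.
rewrite !inE => /or3P[]/eqP->.
- apply: (@check_realizable _ _
    (tabcol [:: [:: 1; 2; 3]; [:: 4; 2; 3]; [:: 4; 2; 3]; [:: 1; 2; 3]])).
  by vm_compute.
- apply: (@check_realizable _ _
    (tabcol [:: [:: 1; 2; 3]; [:: 4; 2; 3]; [:: 2; 4; 3]; [:: 5; 4; 3]])).
  by vm_compute.
- apply: (@check_realizable _ _
    (tabcol [:: [:: 1; 2; 3]; [:: 3; 2; 4]; [:: 4; 5; 3]; [:: 6; 5; 4]])).
  by vm_compute.
Qed.

(** * Assembling all values of [t] *)

Lemma mated_range n t : 3 <= n -> n < t <= n.*2 -> mated n t.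
Proof.
move=> n3; rewrite -(subnKC n3); elim: (n - 3) t => [|m IHm] t t_in.
  have : t \in [:: 4; 5; 6] by rewrite !inE; lia.
  rewrite !inE => /or3P[]/eqP->; [exact: mated3_4 | exact: mated3_5 | exact: mated3_6].
(* Adding one colour reaches every value except the new maximum, which needs two. *)
rewrite addnS in t_in *; have [le_t|gt_t] := leqP t (3 + m).*2.+1.
  by rewrite -(prednK (_ : 0 < t)); [apply/mated_succ/IHm; lia | lia].
have ->: t = t.-2.+2 by lia.
by apply/mated_succ2/IHm; lia.
Qed.

Lemma realizable_range n t :
  3 <= n -> n < t -> t.*2 <= n.+1 * n.+2 -> realizable n t.
Proof.
move=> n3; rewrite -(subnKC n3); elim: (n - 3) t => [|m IHm] t lt_nt le_t.
  have [le6|gt6] := leqP t 6; first by apply/mated_realizable/mated_range; lia.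
  have [->|ne7] := eqVneq t 7; first exact: realizable3_7.
  rewrite -(subnK (_ : 4 <= t)); last lia.
  by apply: realizable_shift; [lia | apply: realizable2; lia].
rewrite addnS in lt_nt le_t *; have [le2|gt2] := leqP t (3 + m).+1.*2.
  by apply/mated_realizable/mated_range; lia.
(* Subtracting [(3 + m).+2] maps the new maximum to the old one, since consecutive triangular
   numbers differ by it; [t] above the mated range leaves at least [(3 + m).+1] colours. *)
rewrite -(subnK (_ : (3 + m).+2 <= t)); last lia.
by apply: realizable_shift; [lia | apply: IHm; lia].
Qed.

Theorem mainTheorem5 (n t : nat) (hn : 3 <= n) (ht : 0 < t) :
  (exists a : coloring (hypercube n), interval_total_coloring t a) <->
  n + 1 <= t <= (n + 1) * (n + 2) %/ 2.
Proof.
rewrite addn1 addn2; split=> [[a /cube_spectra_bound]|/andP[lt_nt]]; first exact.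
rewrite leq_divRL // muln2 => le_t.
by have [c pc oc] := realizable_range hn lt_nt le_t; apply: cube_coloringP pc oc.
Qed.
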